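(* Let $r$ and $q$ be positive integers with $r\geq q+2$. Put $b=r^2+q^2-1$ and $d=2rq$. Then there exists a Type 1 triangle $T_1(2,b,d)$; that is, $b\geq 3$, $2\leq d\leq b-1$, and there is a Pythagorean triangle with one leg of length $d^2$ and hypotenuse of length $d_{2,b}=d(b+1)$.
   Context: A Pythagorean triangle is a right triangle all of whose side lengths are positive integers. For integers $b\geq 3$, $2\leq d\leq b-1$ and $k\geq 2$, $d_{k,b}=d\,(b^{k-1}+\cdots+b+1)=\dfrac{d(b^k-1)}{b-1}$ denotes the positive integer whose base $b$ representation consists of $k$ digits all equal to $d$. A Pythagorean triangle is a Type 1 triangle with base $b$ repeated digits, denoted $T_1(k,b,d)$ (with $b\geq 3$, $2\leq d\leq b-1$, $k\geq 2$), if one of its two legs has length $d^k$ and its hypotenuse has length $d_{k,b}$. *)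

(* Defs.v *)
From mathcomp Require Import all_boot.
Set Implicit Arguments.
Unset Strict Implicit.
Unset Printing Implicit Defensive.

(* A right triangle with integer sides is given by its side lengths: legs x, y
   and hypotenuse z. *)
Definition pythagorean_triangle (x y z : nat) : Prop :=
  [/\ 0 < x, 0 < y, 0 < z & x ^ 2 + y ^ 2 = z ^ 2].

(* d_{k,b} = d * (b^(k-1) + ... + b + 1) *)
Definition repdigit (k b d : nat) : nat := d * \sum_(i < k) b ^ i.

(* The triangle with legs x, y and hypotenuse z is a T_1(k,b,d). *)
Definition type1_triangle (k b d x y z : nat) : Prop :=
  [/\ [/\ 3 <= b, 2 <= d <= b - 1 & 2 <= k],
      pythagorean_triangle x y z,
      x = d ^ k \/ y = d ^ k
    & z = repdigit k b d].

(* Main.v *)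
Require Import Defs.
From mathcomp Require Import all_boot.
From mathcomp Require Import zify.

(** Since [b + 1 = r ^ 2 + q ^ 2], the hypotenuse is [d * (r ^ 2 + q ^ 2)] and
    the prescribed leg is [d ^ 2 = d * (2 * r * q)].  These are [d] times two
    sides of Euclid's triangle [(2rq, r^2 - q^2, r^2 + q^2)], so the other leg
    is [d * (r ^ 2 - q ^ 2)].  The digit bound [d <= b - 1] says
    [2 <= (r - q) ^ 2], which is where the gap [q + 2 <= r] enters. *)
Theorem mainTheorem9 (r q : nat) (hr : 0 < r) (hq : 0 < q) (hrq : q + 2 <= r) :
  let b := r ^ 2 + q ^ 2 - 1 in
  let d := 2 * r * q in
  exists x y z : nat, type1_triangle 2 b d x y z.
Proof.
move=> b d.
have qr : q < r by lia.
have rq_sqr : q ^ 2 < r ^ 2 by rewrite ltn_exp2r.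
have d_gt0 : 0 < d by rewrite /d !muln_gt0 hr hq.
have b1E : b + 1 = r ^ 2 + q ^ 2 by rewrite /b; lia.
have gap : d + 4 <= b + 1.
  rewrite b1E /d; have -> : r = q + 2 + (r - (q + 2)) by lia.
  by rewrite -!mulnn; nia.
exists (d ^ 2), (d * (r ^ 2 - q ^ 2)), (d * (r ^ 2 + q ^ 2)).
split; [split| |by left|].
- by lia.
- by rewrite /d in gap *; nia.
- by [].
- split.
  + by rewrite expn_gt0 d_gt0.
  + by rewrite muln_gt0 d_gt0 subn_gt0.
  + by rewrite muln_gt0 d_gt0 -b1E addn1.
  + have -> : d ^ 2 = d * (2 * r * q) by [].
    rewrite !(expnMn d) -mulnDr; congr (_ * _).
    (* With r ^ 2 = q ^ 2 + t, both sides are (2 * q ^ 2 + t) ^ 2. *)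
    have := subnKC (ltnW rq_sqr); set t := r ^ 2 - q ^ 2 => <-.
    have -> : (2 * r * q) ^ 2 = 4 * (q ^ 2 + t) * q ^ 2.
      by rewrite !expnMn subnKC // ltnW.
    by rewrite -(mulnn t) -(mulnn (_ + _)); nia.
- by rewrite /repdigit big_ord_recr big_ord1 /= expn0 expn1 (addnC 1) b1E.
Qed.
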